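(* Let $C$ be a special spacelike Frenet curve in $E_1^4$, parametrized by arc length $\mathbf c:L\to E_1^4$, with Frenet frame $\{\mathbf e_1,\mathbf e_2,\mathbf e_3,\mathbf e_4\}$ and first and second curvature functions $k_1,k_2$. If $C$ is a generalized spacelike Mannheim curve, then there is a constant $\alpha$ such that $$k_1(s)=-\alpha\left(\mu_1k_1^2(s)+\mu_2k_2^2(s)\right)\quad\text{for all } s\in L,$$ where $\mu_1=\mu_2=-1$ when $\mathbf e_4$ is timelike, $\mu_1=-1,\ \mu_2=1$ when $\mathbf e_3$ is timelike, and $\mu_1=\mu_2=1$ when $\mathbf e_2$ is timelike.
   Context: Minkowski space-time $E_1^4$ is $\mathbb R^4$ with the metric $\langle x,y\rangle=-x_1y_1+x_2y_2+x_3y_3+x_4y_4$, and $\|v\|=\sqrt{|\langle v,v\rangle|}$. A vector $v$ is spacelike if $\langle v,v\rangle>0$ or $v=0$, timelike if $\langle v,v\rangle<0$, null if $\langle v,v\rangle=0$ and $v\neq0$. All curves are regular $C^\infty$ curves whose velocity vectors are spacelike; $L\subset\mathbb R$ is an interval, and $\mathbf c:L\to E_1^4$ is an arc-length parametrization if $\langle\mathbf c'(s),\mathbf c'(s)\rangle=1$ for all $s\in L$. Special spacelike Frenet curve: a spacelike curve $C$ with arc-length parametrization $\mathbf c:L\to E_1^4$ admitting smooth functions $k_1>0$, $k_2>0$, $k_3$ (nowhere zero) on $L$ and a smooth, positively oriented (determinant $+1$), orthonormal frame $\{\mathbf e_1,\mathbf e_2,\mathbf e_3,\mathbf e_4\}$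 of non-null vector fields along $C$, with $\mathbf e_1=\mathbf c'$ and $$\mathbf e_1'=k_1\mathbf e_2,\quad \mathbf e_2'=\mu_1k_1\mathbf e_1+k_2\mathbf e_3,\quad \mathbf e_3'=\mu_2k_2\mathbf e_2+k_3\mathbf e_4,\quad \mathbf e_4'=\mu_3k_3\mathbf e_3.$$ Exactly one of $\mathbf e_2,\mathbf e_3,\mathbf e_4$ is timelike (with $\langle\mathbf e_i,\mathbf e_i\rangle=-1$), the other frame vectors being spacelike unit vectors, and: if $\mathbf e_4$ is timelike, $(\mu_1,\mu_2,\mu_3)=(-1,-1,1)$; if $\mathbf e_3$ is timelike, $(\mu_1,\mu_2,\mu_3)=(-1,1,1)$; if $\mathbf e_2$ is timelike, $(\mu_1,\mu_2,\mu_3)=(1,1,-1)$. The functions $k_1,k_2,k_3$ are the first, second and third curvature functions. In particular $k_1=\|\mathbf e_1'\|$ and $k_2=\|\mathbf e_2'-\mu_1k_1\mathbf e_1\|$. The lines through a point of $C$ in the directions of $\mathbf e_2,\mathbf e_3,\mathbf e_4$ are the first, second and third normal lines of $C$ at that point. Generalized spacelike Mannheim curve: a special spacelike Frenet curve $C$ for which there exist a special spacelike Frenet curve $C^*$ (with frame $\{\mathbf e_1^*,\dots,\mathbf e_4^*\}$) and a bijection $\phi:C\to C^*$ such that at each point of $C$ the first normal line of $C$ is included in the plane generated by the second and third normal lines of $C^*$ at the corresponding point under $\phi$. $C^*$ is called the generalized spacelike Mannheim mate curve of $C$. By this definition the mate is taken to be given by $\mathbf c^*(s)=\mathbf c(s)+\alpha(s)\mathbf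 e_2(s)$, $s\in L$, with $\alpha$ a smooth function on $L$ and $\phi(\mathbf c(s))=\mathbf c^*(s)$. The parameter $s$ need not be arc length on $C^*$; the frame of $C^*$ is taken with respect to its arc-length parameter $s^*=f(s)=\int_0^s\|d\mathbf c^*/ds\|\,ds$. *)

(* Defs.v *)
From HB Require Import structures.
From mathcomp Require Import all_boot all_order all_algebra.
From mathcomp Require Import all_classical all_reals all_analysis.

Set Implicit Arguments.
Unset Strict Implicit.
Unset Printing Implicit Defensive.

Import Order.TTheory GRing.Theory Num.Theory.
Import numFieldNormedType.Exports.

Local Open Scope classical_set_scope.
Local Open Scope ring_scope.

(* Calculus on an interval L which may contain its endpoints: difference
   quotients are taken along L, so the derivative is one-sided at an endpoint
   of L and is the usual derivative at an interior point. *)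
Section DerivativeAlong.
Context {R : realType} {V : normedModType R}.
Implicit Types (L : set R) (f : R -> V).

Definition difference_quotient f (s t : R) : V := (t - s)^-1 *: (f t - f s).

Definition derivable_on L f (s : R) : Prop :=
  cvg (difference_quotient f s @ within L s^').

Definition derive_on L f (s : R) : V :=
  lim (difference_quotient f s @ within L s^').

Definition smooth_on L f : Prop :=
  forall (n : nat) (s : R), L s -> derivable_on L (iter n (derive_on L) f) s.

End DerivativeAlong.

(* Single points are excluded: a curve needs a derivative at each parameter. *)
Definition proper_interval {R : realType} (L : set R) : Prop :=
  is_interval L /\ exists a b : R, [/\ L a, L b & a < b].

Section Minkowski.
Context {R : realType}.
Implicit Types (x y v w p : 'rV[R]_4).

(* The coordinates x_1, ..., x_4 are x 0 0, ..., x 0 3. *)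
Definition minkowski x y : R :=
  - (x 0 0 * y 0 0) + x 0 1 * y 0 1 + x 0 2 * y 0 2 + x 0 3 * y 0 3.

Definition minkowski_norm v : R := Num.sqrt `|minkowski v v|.

Definition spacelike v : Prop := 0 < minkowski v v \/ v = 0.

Definition line_through p v : set 'rV[R]_4 :=
  [set q | exists a : R, q = p + a *: v].

Definition plane_through p v w : set 'rV[R]_4 :=
  [set q | exists a b : R, q = p + a *: v + b *: w].

Definition spacelike_curve (L : set R) (c : R -> 'rV[R]_4) : Prop :=
  smooth_on L c /\
  forall s, L s -> spacelike (derive_on L c s) /\ derive_on L c s != 0.

Definition arc_length_parametrized (L : set R) (c : R -> 'rV[R]_4) : Prop :=
  forall s, L s -> minkowski (derive_on L c s) (derive_on L c s) = 1.

(* The oriented integral of the speed of c from s0 to s, with s0, s in L. *)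
Definition arc_length (L : set R) (c : R -> 'rV[R]_4) (s0 s : R) : R :=
  let speed t := minkowski_norm (derive_on L c t) in
  if s0 <= s then \int[lebesgue_measure]_(t in `[s0, s]) speed t
  else - \int[lebesgue_measure]_(t in `[s, s0]) speed t.

End Minkowski.

Variant timelike_vector := E2_timelike | E3_timelike | E4_timelike.

(* Position of the timelike vector in the frame, counted from 0. *)
Definition timelike_index (T : timelike_vector) : nat :=
  match T with E2_timelike => 1 | E3_timelike => 2 | E4_timelike => 3 end.

Section Signs.
Context {R : realType}.

Definition mu1 (T : timelike_vector) : R :=
  match T with E2_timelike => 1 | E3_timelike => -1 | E4_timelike => -1 end.

Definition mu2 (T : timelike_vector) : R :=
  match T with E2_timelike => 1 | E3_timelike => 1 | E4_timelike => -1 end.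

Definition mu3 (T : timelike_vector) : R :=
  match T with E2_timelike => -1 | E3_timelike => 1 | E4_timelike => 1 end.

End Signs.

Record frenet_apparatus (R : realType) := FrenetApparatus {
  tl : timelike_vector;
  e1 : R -> 'rV[R]_4;
  e2 : R -> 'rV[R]_4;
  e3 : R -> 'rV[R]_4;
  e4 : R -> 'rV[R]_4;
  k1 : R -> R;
  k2 : R -> R;
  k3 : R -> R
}.

Section Curves.
Context {R : realType}.
Implicit Types (L : set R) (c : R -> 'rV[R]_4) (F : frenet_apparatus R).

Definition frame_vector F (s : R) (i : 'I_4) : 'rV[R]_4 :=
  nth 0 [:: e1 F s; e2 F s; e3 F s; e4 F s] i.

Definition orthonormal_at F (s : R) : Prop :=
  forall i j : 'I_4, minkowski (frame_vector F s i) (frame_vector F s j) =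
    if i != j then 0 else if i == timelike_index (tl F) :> nat then -1 else 1.

Definition positively_oriented_at F (s : R) : Prop :=
  \det (\matrix_(i < 4) frame_vector F s i) = 1.

Definition frenet_equations_at L F (s : R) : Prop :=
  let T := tl F in
  [/\ derive_on L (e1 F) s = k1 F s *: e2 F s,
      derive_on L (e2 F) s = (mu1 T * k1 F s) *: e1 F s + k2 F s *: e3 F s,
      derive_on L (e3 F) s = (mu2 T * k2 F s) *: e2 F s + k3 F s *: e4 F s &
      derive_on L (e4 F) s = (mu3 T * k3 F s) *: e3 F s].

Record special_spacelike_frenet L c F : Prop := SpecialSpacelikeFrenet {
  ssf_interval : proper_interval L;
  ssf_curve : spacelike_curve L c;
  ssf_arc_length : arc_length_parametrized L c;
  ssf_smooth_frame : [/\ smooth_on L (e1 F), smooth_on L (e2 F),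
                         smooth_on L (e3 F) & smooth_on L (e4 F)];
  ssf_smooth_curvatures : [/\ smooth_on L (k1 F : R -> R^o),
                              smooth_on L (k2 F : R -> R^o) &
                              smooth_on L (k3 F : R -> R^o)];
  ssf_k1 : forall s, L s -> 0 < k1 F s;
  ssf_k2 : forall s, L s -> 0 < k2 F s;
  ssf_k3 : forall s, L s -> k3 F s != 0;
  ssf_orthonormal : forall s, L s -> orthonormal_at F s;
  ssf_oriented : forall s, L s -> positively_oriented_at F s;
  ssf_tangent : forall s, L s -> e1 F s = derive_on L c s;
  ssf_equations : forall s, L s -> frenet_equations_at L F s
}.

Definition first_normal_line c F (s : R) : set 'rV[R]_4 :=
  line_through (c s) (e2 F s).

(* The plane generated by the second and third normal lines. *)
Definition normal_plane c F (s : R) : set 'rV[R]_4 :=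
  plane_through (c s) (e3 F s) (e4 F s).

(* The mate has the arc-length parametrization cm : Lm -> E_1^4 and the frame
   Fm.  The function f is the arc length s |-> s* of the curve
   c + alpha e_2, measured from some base point s0 of L. *)
Record mannheim_mate L c F (Lm : set R) (cm : R -> 'rV[R]_4)
    (Fm : frenet_apparatus R) (alpha f : R -> R)
    (phi : 'rV[R]_4 -> 'rV[R]_4) : Prop := MannheimMate {
  mm_frenet : special_spacelike_frenet Lm cm Fm;
  mm_alpha : smooth_on L (alpha : R -> R^o);
  mm_curve : spacelike_curve L (fun s => c s + alpha s *: e2 F s);
  mm_arc_length : exists2 s0, L s0 & forall s, L s ->
    f s = arc_length L (fun t => c t + alpha t *: e2 F t) s0 s;
  mm_range : f @` L = Lm;
  mm_param : forall s, L s -> cm (f s) = c s + alpha s *: e2 F s;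
  mm_bij : set_bij (c @` L) (cm @` Lm) phi;
  mm_phi : forall s, L s -> phi (c s) = c s + alpha s *: e2 F s;
  mm_normal : forall s, L s -> first_normal_line c F s `<=` normal_plane cm Fm (f s)
}.

Definition generalized_spacelike_mannheim L c F : Prop :=
  special_spacelike_frenet L c F /\
  exists Lm cm Fm alpha f phi, mannheim_mate L c F Lm cm Fm alpha f phi.

End Curves.

(* Main.v *)
Require Import Defs.
From mathcomp Require Import all_boot all_order all_algebra.
From mathcomp Require Import all_classical all_reals all_analysis.
From mathcomp Require Import ring lra.
(* [minkowski] is to denote the Lorentzian form, not the integral inequality. *)
Import Defs.

Set Implicit Arguments.
Unset Strict Implicit.
Unset Printing Implicit Defensive.

Import Order.TTheory GRing.Theory Num.Theory.
Import numFieldNormedType.Exports.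
Local Open Scope classical_set_scope.
Local Open Scope ring_scope.

(** Write the mate as [g = c + alpha e2], so that [g s = cm (f s)] with [f] the
    arc length of [g].  The first normal line of [c] lies in the plane through
    [cm (f s)] spanned by [e3*] and [e4*]; hence [e2] is orthogonal to [e1*]
    and to [e2*] at corresponding points ([mate_contains_first_normal]).  The
    claim follows by differentiating these relations along the interval.

    The derivative [g' = e1 + alpha' e2 + alpha e2'] is a multiple of [e1*], so
    its product with [e2] vanishes.  This product is [alpha' <e2, e2>], since
    [e1] and [e2'] are orthogonal to [e2]; therefore [alpha' = 0] and [alpha]
    is constant.

    The function [<e1* o f, e2>] vanishes identically.  Its derivative is
    [f' k1* <e2*, e2> + <e1*, e2'>], whose first term is zero, so [e1*], and
    with it [g'], is orthogonal to [e2'].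

    Now [g' = e1 + alpha e2'] and [e2' = mu1 k1 e1 + k2 e3], so [<g', e2'> = 0]
    reads [mu1 k1 + alpha (k1^2 + <e3, e3> k2^2) = 0].  Multiplying by [mu1]
    and using [mu1^2 = 1] and [mu1 <e3, e3> = mu2] gives the claim.

    The analysis behind this is one-sided at the ends of the interval.  The
    product and chain rules come from the factorization [has_derivative_onP];
    [arc_length_has_derivative] is the fundamental theorem of calculus for [f],
    and [derivative_on_eq0_cst] is the mean value theorem for [alpha]. *)

(** * Derivatives along a set *)

Definition has_derivative_on {R : realType} {V : normedModType R} (L : set R)
    (f : R -> V) (s : R) (l : V) : Prop :=
  difference_quotient f s @ within L s^' --> l.

Definition continuous_on {R : realType} {V : normedModType R} (L : set R)
    (f : R -> V) (s : R) : Prop :=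
  f @ within L (nbhs s) --> f s.

Lemma smooth_on_has_derivative {R : realType} {V : normedModType R} (L : set R)
    (f : R -> V) (n : nat) (s : R) (smf : smooth_on L f) (Ls : L s) :
  has_derivative_on L (iter n (derive_on L) f) s
    (iter n.+1 (derive_on L) f s).
Proof. exact: smf n s Ls. Qed.

(** Caratheodory's form of differentiability.  The factor [Q] is continuous at
    [s] itself, which frees the product and chain rules from any division and
    from the points where [f t = f s]. *)
Lemma has_derivative_onP {R : realType} {V : normedModType R} (L : set R)
    (f : R -> V) (s : R) (l : V) :
  has_derivative_on L f s l <->
  exists Q : R -> V, [/\ Q s = l, continuous_on L Q s &
    forall t, f t = f s + (t - s) *: Q t].
Proof.
split=> [fl|[Q [<- Qs fQ]]].
- exists (fun t => if t == s then l else difference_quotient f s t).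
  split; first by rewrite eqxx.
  + rewrite /continuous_on eqxx => U lU.
    have : \forall t \near s, t != s -> L t -> U (difference_quotient f s t).
      exact: fl _ lU.
    apply: filterS => t tU Lt /=.
    by case: eqVneq => [_|ts]; [exact: nbhs_singleton lU|exact: tU].
  + move=> t; case: eqVneq => [->|ts]; first by rewrite subrr scale0r addr0.
    by rewrite scalerA mulfV ?subr_eq0 // scale1r addrC subrK.
- move=> U lU; have : \forall t \near s, L t -> U (Q t) by exact: Qs _ lU.
  apply: filterS => t tU ts Lt; rewrite /= /difference_quotient (fQ t).
  rewrite addrAC subrr add0r.
  by rewrite scalerA mulVf ?subr_eq0 // scale1r; exact: tU.
Qed.

Lemma has_derivative_on_continuous {R : realType} {V : normedModType R}
    (L : set R) (f : R -> V) (s : R) (l : V) :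
  has_derivative_on L f s l -> continuous_on L f s.
Proof.
move=> /has_derivative_onP[Q [_ Qs fQ]].
rewrite /continuous_on [X in X @ _](_ : _ = fun t => f s + (t - s) *: Q t);
  last exact/funext.
rewrite -[X in _ --> X]addr0 -[X in _ --> _ + X](scale0r (Q s)).
rewrite -[X in _ --> _ + X *: _](subrr s).
apply: cvgD; first exact: cvg_cst.
apply: cvgZ => //; apply: cvgB; [exact: cvg_within|exact: cvg_cst].
Qed.

Lemma has_derivative_on_cst {R : realType} {V : normedModType R} (L : set R)
    (v : V) (s : R) : has_derivative_on L (fun=> v) s 0.
Proof.
apply/has_derivative_onP; exists (fun=> 0); split=> //; first exact: cvg_cst.
by move=> t; rewrite scaler0 addr0.
Qed.

Lemma has_derivative_onD {R : realType} {V : normedModType R} (L : set R)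
    (f g : R -> V) (s : R) (l m : V) :
  has_derivative_on L f s l -> has_derivative_on L g s m ->
  has_derivative_on L (fun t => f t + g t) s (l + m).
Proof.
move=> /has_derivative_onP[P [<- Ps fP]] /has_derivative_onP[Q [<- Qs gQ]].
apply/has_derivative_onP; exists (fun t => P t + Q t); split=> //.
  exact: cvgD.
by move=> t; rewrite fP gQ scalerDr addrACA.
Qed.

(** Leibniz's rule, used both for the scalar multiple [alpha *: e2] and for the
    Lorentzian product of two vector fields. *)
Lemma has_derivative_on_bilinear {R : realType} {U V W : normedModType R}
    (B : U -> V -> W) (L : set R) (f : R -> U) (g : R -> V) (s : R)
    (l : U) (m : V) :
  (forall v, linear (B^~ v)) -> (forall u, linear (B u)) ->
  continuous (fun z : U * V => B z.1 z.2) ->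
  has_derivative_on L f s l -> has_derivative_on L g s m ->
  has_derivative_on L (fun t => B (f t) (g t)) s (B l (g s) + B (f s) m).
Proof.
move=> Bl Br Bc df dg.
have gs := has_derivative_on_continuous dg.
move: df dg => /has_derivative_onP[P [<- Ps fP]].
move=> /has_derivative_onP[Q [<- Qs gQ]]; apply/has_derivative_onP.
exists (fun t => B (P t) (g t) + B (f s) (Q t)); split=> //.
  apply: cvgD.
    exact: (cvg_comp2 Ps gs (Bc (P s, g s))).
  exact: (cvg_comp2 (cvg_cst (f s)) Qs (Bc (f s, Q s))).
move=> t; rewrite {1}fP [f s + _]addrC Bl [in B (f s) (g t)]gQ [g s + _]addrC.
by rewrite Br scalerDr addrA addrC.
Qed.

Lemma has_derivative_on_comp {R : realType} {V : normedModType R}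
    (L M : set R) (f : R -> R^o) (g : R -> V) (s : R) (l : R^o) (m : V) :
  (forall t, L t -> M (f t)) ->
  has_derivative_on L f s l -> has_derivative_on M g (f s) m ->
  has_derivative_on L (fun t => g (f t)) s (l *: m).
Proof.
move=> LM df dg.
have fs := has_derivative_on_continuous df.
move: df dg => /has_derivative_onP[P [<- Ps fP]].
move=> /has_derivative_onP[Q [<- Qs gQ]].
apply/has_derivative_onP; exists (fun t => P t *: Q (f t)); split=> //.
  apply: cvgZ => //; move=> U /Qs nU.
  have : \forall t \near s, L t -> M (f t) -> U (Q (f t)) by exact: (fs _ nU).
  by apply: filterS => t tU Lt; apply: tU => //; exact: LM.
by move=> t; rewrite gQ {1}(fP t) addrAC subrr add0r scalerA.
Qed.

Lemma has_derivative_on_eq {R : realType} {V : normedModType R}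
    (L : set R) (f g : R -> V) (s : R) (l : V) :
  L s -> (forall t, L t -> f t = g t) ->
  has_derivative_on L f s l -> has_derivative_on L g s l.
Proof.
move=> Ls fg; apply: cvg_trans; apply: fmap_within_eq => t; rewrite inE => Lt.
by rewrite /difference_quotient !fg.
Qed.

(** Moving from [s] towards another point of the interval stays inside it, so
    [s] is an accumulation point of [L]; this is what makes limits along [L]
    unique, also at the endpoints. *)
Lemma proper_interval_within_dnbhs {R : realType} (L : set R) (s : R) :
  proper_interval L -> L s -> ProperFilter (within L s^').
Proof.
move=> [iL [a [b [La Lb ab]]]] Ls.
have [d [Ld ds]] : exists d, L d /\ d != s.
  case: (eqVneq a s) => [as_|]; last by exists a.
  by exists b; split => //; rewrite -as_ gt_eqF.
apply: Build_ProperFilter_ex => P PL.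
have nP : \forall t \near s, t != s -> L t -> P t by exact: PL.
have cv : s + r * (d - s) @[r --> 0^'+] --> s.
  rewrite -[X in _ --> X]addr0 -[X in _ --> _ + X](mul0r (d - s)).
  apply: cvgD; first exact: cvg_cst.
  by apply: cvgM; [exact: cvg_within|exact: cvg_cst].
near (0 : R)^'+ => r.
have r0 : 0 < r by [].
have r1 : r < 1 by near: r; exact: nbhs_right_lt.
have tP : s + r * (d - s) != s -> L (s + r * (d - s)) -> P (s + r * (d - s)).
  by near: r; exact: cv _ nP.
exists (s + r * (d - s)); apply: tP.
- by rewrite -subr_eq0 addrC addKr mulf_neq0 ?subr_eq0 // gt_eqF.
- by have [sd|sd] := leP s d; [apply: (iL _ _ Ls Ld)|apply: (iL _ _ Ld Ls)]; nra.
Unshelve. all: by end_near.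
Qed.

Lemma has_derivative_on_unique {R : realType} {V : normedModType R}
    (L : set R) (f : R -> V) (s : R) (l m : V) :
  proper_interval L -> L s ->
  has_derivative_on L f s l -> has_derivative_on L f s m -> l = m.
Proof.
move=> pL Ls; have ? := proper_interval_within_dnbhs pL Ls.
exact: cvg_unique.
Qed.

(** The mean value theorem asks for a two-sided derivative only at interior
    points, where a limit along [L] is an ordinary limit. *)
Lemma derivative_on_eq0_cst {R : realType} (L : set R) (f : R -> R^o) :
  is_interval L -> (forall s, L s -> has_derivative_on L f s 0) ->
  forall s t, L s -> L t -> f s = f t.
Proof.
move=> iL df.
have sub a b : L a -> L b -> `[a, b] `<=` L.
  move=> La Lb t; rewrite /= in_itv /= => abt; exact: (iL _ _ La Lb).
suff lt_cst s t : s < t -> L s -> L t -> f s = f t.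
  move=> s t Ls Lt; case: (ltgtP s t) => [st|ts|->] //; first exact: lt_cst.
  by rewrite (lt_cst t s).
move=> st Ls Lt.
have fw : {within `[s, t], continuous f}.
  apply/subspace_continuousP => x xst.
  have := has_derivative_on_continuous (df x (sub _ _ Ls Lt x xst)).
  apply: cvg_trans; apply: cvg_app; apply: within_subset; exact: sub.
have fd x : x \in `]s, t[ -> is_derive x 1 f 0.
  rewrite in_itv /= => /andP[sx xt].
  have Lx : L x by apply: (iL _ _ Ls Lt); rewrite !ltW.
  have nL : \forall y \near x, L y.
    have : \forall y \near x, y \in `]s, t[.
      by apply: near_in_itvoo; rewrite in_itv /= sx.
    apply: filterS => y; rewrite in_itv /= => /andP[sy yt].
    by apply: (iL _ _ Ls Lt); rewrite !ltW.
  have cv : h *: 1 + x @[h --> (0 : R)] --> x.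
    rewrite -[X in _ --> X]add0r -[X in _ --> X + _](scale0r (1 : R)).
    apply: cvgD; last exact: cvg_cst.
    by apply: cvgZ => //; exact: cvg_cst.
  have key : h^-1 *: ((f \o shift x) (h *: 1) - f x) @[h --> 0^'] --> (0 : R^o).
    move=> U /(df x Lx) /= xU.
    have nU : \forall y \near x, y != x -> L y -> U (difference_quotient f x y).
      exact: xU.
    have nU' : \forall y \near x, y != x -> U (difference_quotient f x y).
      by apply: filterS2 nU nL => y yU Ly yx; exact: yU.
    have : \forall h \near 0, h *: 1 + x != x ->
        U (difference_quotient f x (h *: 1 + x)) by exact: cv _ nU'.
    apply: filterS => h hU h0; move: hU.
    rewrite /difference_quotient addrK [h *: 1]mulr1 -subr_eq0 addrK.
    by move=> /(_ h0); rewrite -[in f (h + x)](mulr1 h).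
  by split; [apply/cvg_ex; exists 0|exact: cvg_lim].
have [x _ ] := MVT st fd fw.
by rewrite mul0r => /eqP; rewrite subr_eq0 => /eqP.
Qed.

(** * Indefinite integrals along an interval *)

Lemma Rintegral_mean_near {R : realType} (h : R -> R) (a b v e : R) :
  a < b -> lebesgue_measure.-integrable `[a, b] (EFin \o h) ->
  (forall u, a <= u <= b -> `|h u - v| <= e) ->
  `|(b - a)^-1 * \int[lebesgue_measure]_(u in `[a, b]) h u - v| <= e.
Proof.
move=> ab hi hv.
have ba0 : 0 < b - a by rewrite subr_gt0.
have cstE (k : R) : \int[lebesgue_measure]_(u in `[a, b]) k = k * (b - a).
  by rewrite Rintegral_cst //= lebesgue_measure_itv /= lte_fin ab.
have ci (k : R) : lebesgue_measure.-integrable `[a, b] (EFin \o (fun=> k)).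
  apply: continuous_compact_integrable; first exact: segment_compact.
  by apply: continuous_subspaceT => x; exact: cvg_cst.
have lo : (v - e) * (b - a) <= \int[lebesgue_measure]_(u in `[a, b]) h u.
  rewrite -cstE; apply: le_Rintegral => // u; rewrite /= in_itv /= => /hv.
  by rewrite ler_norml => /andP[]; lra.
have hi' : \int[lebesgue_measure]_(u in `[a, b]) h u <= (v + e) * (b - a).
  rewrite -cstE; apply: le_Rintegral => // u; rewrite /= in_itv /= => /hv.
  by rewrite ler_norml => /andP[]; lra.
rewrite ler_norml lerBrDl [_ - v <= _]lerBlDl ler_pdivlMl // ler_pdivrMl //.
rewrite ![(b - a) * _]mulrC.
by rewrite lo hi'.
Qed.

Lemma Rintegral_itv_chasles {R : realType} (h : R -> R) (a b c : R) :
  a <= b <= c -> lebesgue_measure.-integrable `[a, c] (EFin \o h) ->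
  \int[lebesgue_measure]_(u in `[a, c]) h u =
  \int[lebesgue_measure]_(u in `[a, b]) h u +
  \int[lebesgue_measure]_(u in `[b, c]) h u.
Proof.
move=> /andP[ab bc] hi.
rewrite -(@Rintegral_itv_obnd_cbnd _ b); last first.
  by apply: integrableS hi => //; apply: subset_itvr; rewrite bnd_simp.
by rewrite -(@Rintegral_itvB _ _ (BLeft a) (BRight c)) ?bnd_simp // addrC subrK.
Qed.

(** Shaped like [arc_length], which is by definition the oriented integral of
    the speed. *)
Definition oriented_integral {R : realType} (h : R -> R) (a b : R) : R :=
  if a <= b then \int[lebesgue_measure]_(u in `[a, b]) h u
  else - \int[lebesgue_measure]_(u in `[b, a]) h u.

Lemma oriented_integralB {R : realType} (L : set R) (h : R -> R) (s0 s t : R) :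
  (forall a b, L a -> L b ->
    lebesgue_measure.-integrable `[a, b] (EFin \o h)) ->
  L s0 -> L s -> L t -> s <= t ->
  oriented_integral h s0 t - oriented_integral h s0 s =
  \int[lebesgue_measure]_(u in `[s, t]) h u.
Proof.
move=> hi L0 Ls Lt st; rewrite /oriented_integral.
have [s0s|ss0] := leP s0 s.
  rewrite (le_trans s0s st) (@Rintegral_itv_chasles _ h s0 s t) ?s0s //.
    by rewrite addrAC subrr add0r.
  exact: hi.
have [s0t|ts0] := leP s0 t; rewrite opprK.
  rewrite (@Rintegral_itv_chasles _ h s s0 t) ?(ltW ss0) ?s0t //; last exact: hi.
  exact: addrC.
rewrite (@Rintegral_itv_chasles _ h s t s0) ?st ?(ltW ts0) //; last exact: hi.
by rewrite addrC addrK.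
Qed.

(** The fundamental theorem of calculus along [L]: by continuity [h] is within
    [e] of [h s] between [s] and a nearby [t] of [L], and so is its mean value
    there, which is the difference quotient. *)
Lemma has_derivative_on_oriented_integral {R : realType} (L : set R)
    (h : R -> R^o) (s0 s : R) :
  is_interval L -> (forall t, L t -> continuous_on L h t) -> L s0 -> L s ->
  has_derivative_on L (oriented_integral h s0 : R -> R^o) s (h s).
Proof.
move=> iL hc L0 Ls.
have hi a b : L a -> L b -> lebesgue_measure.-integrable `[a, b] (EFin \o h).
  move=> La Lb; apply: continuous_compact_integrable.
    exact: segment_compact.
  apply/subspace_continuousP => x xab.
  have sub : `[a, b] `<=` L.
    by move=> t; rewrite /= in_itv /=; exact: (iL _ _ La Lb).
  have := hc x (sub x xab).
  by apply: cvg_trans; apply: cvg_app; exact: within_subset.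
apply/cvgrPdist_le => e e0.
have /cvgrPdist_le/(_ e e0) hs := hc s Ls.
have {hs} : \forall t \near s, L t -> `|h s - h t| <= e by exact: hs.
move=> /nbhs_ballP[d /= d0 dh].
suff : \forall t \near s, t != s -> L t ->
  `|h s - difference_quotient (oriented_integral h s0 : R -> R^o) s t| <= e by [].
near=> t => ts Lt.
have td : `|s - t| < d by near: t; exact: nbhsx_ballx.
have near_h u : s <= u <= t \/ t <= u <= s -> `|h u - h s| <= e.
  move=> stu; rewrite distrC; apply: dh.
    rewrite /ball /=; move: td; rewrite !ltr_norml; case: stu; lra.
  by case: stu; [exact: (iL _ _ Ls Lt)|exact: (iL _ _ Lt Ls)].
rewrite distrC /difference_quotient.
have [st|ts'|] := ltgtP s t; last by move/eqP: ts => + /esym.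
  rewrite (oriented_integralB hi) ?(ltW st) //; apply: Rintegral_mean_near => //.
    exact: hi.
  by move=> u su; apply: near_h; left.
(* For t < s both factors of the difference quotient change sign. *)
rewrite -(opprB s t) -(opprB (oriented_integral h s0 s)) invrN.
rewrite scaleNr scalerN opprK.
rewrite (oriented_integralB hi) ?(ltW ts') //; apply: Rintegral_mean_near => //.
  exact: hi.
by move=> u su; apply: near_h; right.
Unshelve. all: by end_near.
Qed.

(** * The Lorentzian product *)

Lemma minkowskiC {R : realType} (x y : 'rV[R]_4) :
  minkowski x y = minkowski y x.
Proof. by rewrite /minkowski; ring. Qed.

Lemma minkowskiDr {R : realType} (x y z : 'rV[R]_4) :
  minkowski x (y + z) = minkowski x y + minkowski x z.
Proof. by rewrite /minkowski !mxE; ring. Qed.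

Lemma minkowskiZr {R : realType} (a : R) (x y : 'rV[R]_4) :
  minkowski x (a *: y) = a * minkowski x y.
Proof. by rewrite /minkowski !mxE; ring. Qed.

Lemma minkowskiDl {R : realType} (x y z : 'rV[R]_4) :
  minkowski (x + y) z = minkowski x z + minkowski y z.
Proof. by rewrite /minkowski !mxE; ring. Qed.

Lemma minkowskiZl {R : realType} (a : R) (x y : 'rV[R]_4) :
  minkowski (a *: x) y = a * minkowski x y.
Proof. by rewrite /minkowski !mxE; ring. Qed.

Lemma minkowski_linearr {R : realType} (x : 'rV[R]_4) :
  linear (minkowski x : 'rV[R]_4 -> R^o).
Proof. by move=> a y z; rewrite minkowskiDr minkowskiZr. Qed.

Lemma minkowski_linearl {R : realType} (y : 'rV[R]_4) :
  linear ((minkowski (R := R))^~ y : 'rV[R]_4 -> R^o).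
Proof. by move=> a x z; rewrite minkowskiDl minkowskiZl. Qed.

Lemma cvg_minkowski {R : realType} (T : Type) (G : set_system T)
    {FG : Filter G} (f g : T -> 'rV[R]_4) (x y : 'rV[R]_4) :
  f @ G --> x -> g @ G --> y ->
  minkowski (f t) (g t) @[t --> G] --> minkowski x y.
Proof.
move=> fx gy.
have fxi i : f t 0 i @[t --> G] --> x 0 i.
  exact: (cvg_comp _ _ fx (@coord_continuous R _ _ 0 i x)).
have gyi i : g t 0 i @[t --> G] --> y 0 i.
  exact: (cvg_comp _ _ gy (@coord_continuous R _ _ 0 i y)).
apply: cvgD; last exact: cvgM.
apply: cvgD; last exact: cvgM.
apply: cvgD; last exact: cvgM.
by apply: cvgN; exact: cvgM.
Qed.

Lemma minkowski_continuous {R : realType} :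
  continuous (fun z : 'rV[R]_4 * 'rV[R]_4 => minkowski z.1 z.2 : R^o).
Proof.
move=> z; apply: (@cvg_minkowski R _ (nbhs z) _ fst snd z.1 z.2).
  exact: cvg_fst.
exact: cvg_snd.
Qed.

Lemma cvg_minkowski_norm {R : realType} (T : Type) (G : set_system T)
    {FG : Filter G} (f : T -> 'rV[R]_4) (x : 'rV[R]_4) :
  f @ G --> x -> minkowski_norm (f t) @[t --> G] --> minkowski_norm x.
Proof.
move=> fx; have q : `|minkowski (f t) (f t)| @[t --> G] --> `|minkowski x x|.
  by apply: (@cvg_norm _ R^o); exact: cvg_minkowski.
exact: (cvg_comp _ _ q (@sqrt_continuous R _)).
Qed.

(** * Frenet frames and Mannheim mates *)

(** In each of the three causal types the squares of [e2] and [e3] are products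
    of the signs in the Frenet equations.  These expressions are forced by the
    equations themselves, on differentiating [<e1, e2> = 0] and
    [<e2, e3> = 0]; they allow all types to be treated at once. *)
Lemma orthonormal_products {R : realType} (F : frenet_apparatus R) (s : R) :
  orthonormal_at F s ->
  [/\ minkowski (e1 F s) (e1 F s) = 1, minkowski (e1 F s) (e2 F s) = 0,
      minkowski (e1 F s) (e3 F s) = 0 & minkowski (e1 F s) (e4 F s) = 0] /\
  [/\ minkowski (e2 F s) (e2 F s) = - mu1 (tl F),
      minkowski (e2 F s) (e3 F s) = 0, minkowski (e2 F s) (e4 F s) = 0 &
      minkowski (e3 F s) (e3 F s) = mu1 (tl F) * mu2 (tl F)].
Proof.
move=> oF.
pose i0 := @Ordinal 4 0 isT; pose i1 := @Ordinal 4 1 isT.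
pose i2 := @Ordinal 4 2 isT; pose i3 := @Ordinal 4 3 isT.
have := (oF i0 i0, oF i0 i1, oF i0 i2, oF i0 i3,
         oF i1 i1, oF i1 i2, oF i1 i3, oF i2 i2).
rewrite /frame_vector /=.
case: (tl F); move=> /= [[[[[[[[-> ->] ->] ->] ->] ->] ->] ->]];
  by rewrite ?mulr1 ?mul1r ?mulN1r ?opprK.
Qed.

Lemma arc_length_has_derivative {R : realType} (L : set R)
    (c : R -> 'rV[R]_4) (s0 s : R) :
  is_interval L -> smooth_on L c -> L s0 -> L s ->
  has_derivative_on L (arc_length L c s0 : R -> R^o) s
    (minkowski_norm (derive_on L c s)).
Proof.
move=> iL smc L0 Ls.
apply: (@has_derivative_on_oriented_integral R L
  (fun t => minkowski_norm (derive_on L c t)) s0 s) => // t Lt.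
have dt := has_derivative_on_continuous
  (smooth_on_has_derivative (n := 1%N) smc Lt).
exact: cvg_minkowski_norm dt.
Qed.

(** Two points of the line, [c s] and [c s + e2 F s], already lie in the plane,
    so their difference [e2 F s] lies in the direction of the plane, whatever
    its base point. *)
Lemma mate_contains_first_normal {R : realType} (c cm : R -> 'rV[R]_4)
    (F Fm : frenet_apparatus R) (s t : R) :
  first_normal_line c F s `<=` normal_plane cm Fm t ->
  exists a b : R, e2 F s = a *: e3 Fm t + b *: e4 Fm t.
Proof.
move=> sub.
have [|a [b cs]] := sub (c s); first by exists 0; rewrite scale0r addr0.
have [|a' [b' cs']] := sub (c s + e2 F s); first by exists 1; rewrite scale1r.
exists (a' - a), (b' - b).
apply: (addrI (c s)); rewrite cs' cs !scalerBl.
by apply/rowP => i; rewrite !mxE; ring.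
Qed.

Theorem theorem3p1 (R : realType) (L : set R) (c : R -> 'rV[R]_4)
    (F : frenet_apparatus R) :
  special_spacelike_frenet L c F ->
  generalized_spacelike_mannheim L c F ->
  exists alpha : R, forall s : R, L s ->
    k1 F s = - alpha * (mu1 (tl F) * k1 F s ^+ 2 + mu2 (tl F) * k2 F s ^+ 2).
Proof.
move=> sF [_ [Lm [cm [Fm [alpha [f [phi mate]]]]]]].
have pL := ssf_interval sF; have iL := pL.1.
have [_ sme2 _ _] := ssf_smooth_frame sF.
have sFm := mm_frenet mate.
have [sme1m _ _ _] := ssf_smooth_frame sFm.
pose g t := c t + alpha t *: e2 F t.
have [smg _] : spacelike_curve L g := mm_curve mate.
have fLm t : L t -> Lm (f t) by move=> Lt; rewrite -(mm_range mate); exists t.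
have dc s : L s -> has_derivative_on L c s (e1 F s).
  move=> Ls; rewrite (ssf_tangent sF Ls).
  exact: (smooth_on_has_derivative (n := 0%N) (ssf_curve sF).1 Ls).
have de2 s (Ls : L s) : has_derivative_on L (e2 F) s (derive_on L (e2 F) s).
  exact: (smooth_on_has_derivative (n := 0%N) sme2 Ls).
have dalpha s (Ls : L s) :=
  smooth_on_has_derivative (n := 0%N) (mm_alpha mate) Ls.
have g'E s : L s -> derive_on L g s = e1 F s +
    (derive_on L (alpha : R -> R^o) s *: e2 F s +
     alpha s *: derive_on L (e2 F) s).
  move=> Ls; apply: (has_derivative_on_unique pL Ls
    (smooth_on_has_derivative (n := 0%N) smg Ls)).
  apply: has_derivative_onD; first exact: dc.
  apply: (@has_derivative_on_bilinear R R^o _ _ (fun a v => a *: v)) => //.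
  - by move=> v a x y; rewrite scalerDl scalerA.
  - by move=> u a x y; rewrite scalerDr !scalerA mulrC.
  - by move=> z; apply: cvgZ; [exact: cvg_fst|exact: cvg_snd].
  - exact: dalpha.
  - exact: de2.
pose speed s := minkowski_norm (derive_on L g s).
have df s : L s -> has_derivative_on L (f : R -> R^o) s (speed s).
  move=> Ls; have [s0 L0 fE] := mm_arc_length mate.
  apply: (@has_derivative_on_eq _ _ _ (arc_length L g s0)) => //.
    by move=> t Lt; rewrite fE.
  exact: arc_length_has_derivative.
(* The same derivative, computed through the parametrization of the mate. *)
have g'm s : L s -> derive_on L g s = speed s *: e1 Fm (f s).
  move=> Ls; apply: (has_derivative_on_unique pL Ls
    (smooth_on_has_derivative (n := 0%N) smg Ls)).
  apply: (@has_derivative_on_eq _ _ _ (fun t => cm (f t))) => //.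
    by move=> t Lt; rewrite (mm_param mate).
  apply: (has_derivative_on_comp fLm (df s Ls)).
  rewrite (ssf_tangent sFm (fLm _ Ls)).
  exact: (smooth_on_has_derivative (n := 0%N) (ssf_curve sFm).1 (fLm _ Ls)).
have perp s : L s -> minkowski (e1 Fm (f s)) (e2 F s) = 0 /\
    minkowski (e2 Fm (f s)) (e2 F s) = 0.
  move=> Ls; have [a [b ->]] := mate_contains_first_normal (mm_normal mate Ls).
  have [[_ _ m13 m14] [_ m23 m24 _]] :=
    orthonormal_products (ssf_orthonormal sFm (fLm _ Ls)).
  by rewrite !minkowskiDr !minkowskiZr m13 m14 m23 m24 !mulr0 addr0.
have alpha'0 s : L s -> derive_on L (alpha : R -> R^o) s = 0.
  move=> Ls; have [m12 _] := perp s Ls.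
  have [_ de2E _ _] := ssf_equations sF Ls.
  have [[_ p12 _ _] [p22 p23 _ _]] :=
    orthonormal_products (ssf_orthonormal sF Ls).
  have : minkowski (derive_on L g s) (e2 F s) = 0.
    by rewrite g'm // minkowskiZl m12 mulr0.
  rewrite g'E // de2E !minkowskiDl !minkowskiZl minkowskiDl !minkowskiZl.
  rewrite p12 p22 [minkowski (e3 F s) _]minkowskiC p23.
  by case: (tl F) => /=; lra.
have [_ [s0 [_ [L0 _ _]]]] := pL.
exists (alpha s0) => s Ls.
have alphaE : alpha s = alpha s0.
  apply: (derivative_on_eq0_cst (f := alpha) iL) => // t Lt.
  by rewrite -(alpha'0 t Lt); exact: dalpha.
have [_ de2E _ _] := ssf_equations sF Ls.
have [de1mE _ _ _] := ssf_equations sFm (fLm _ Ls).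
have [[p11 _ p13 _] [_ _ _ p33]] :=
  orthonormal_products (ssf_orthonormal sF Ls).
(* Differentiate <e1* o f, e2> = 0. *)
have perp' : minkowski (e1 Fm (f s)) (derive_on L (e2 F) s) = 0.
  have d1 : has_derivative_on L (fun t => e1 Fm (f t)) s
      (speed s *: (k1 Fm (f s) *: e2 Fm (f s))).
    apply: (has_derivative_on_comp fLm (df s Ls)); rewrite -de1mE.
    exact: (smooth_on_has_derivative (n := 0%N) sme1m (fLm _ Ls)).
  have d0 := has_derivative_on_bilinear (@minkowski_linearl R)
    (@minkowski_linearr R) (@minkowski_continuous R) d1 (de2 s Ls).
  have := has_derivative_on_unique pL Ls d0.
  move=> /(_ 0); rewrite !minkowskiZl (perp s Ls).2 !mulr0 add0r; apply.
  apply: (@has_derivative_on_eq _ _ _ (fun=> 0)) => //.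
    by move=> t Lt; rewrite (perp t Lt).1.
  exact: has_derivative_on_cst.
have : minkowski (derive_on L g s) (derive_on L (e2 F) s) = 0.
  by rewrite g'm // minkowskiZl perp' mulr0.
rewrite g'E // alpha'0 // scale0r add0r de2E alphaE.
rewrite !(minkowskiDl, minkowskiDr, minkowskiZl, minkowskiZr).
rewrite [minkowski (e3 F s) (e1 F s)]minkowskiC p11 p13 p33.
case: (tl F) => /=; nra.
Qed.
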